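(* Let $T_E$ be locally finite, let $\mathcal S=(a,I,\tau)$ be an array-based system and $U$ an $\exists^I$-formula. If there exists a safety invariant for $U$, then there are finitely many configurations $s_1,\dots,s_k$ which are sub-reachable from $U$ and such that $\neg(K_{s_1}\vee\dots\vee K_{s_k})$ is also a safety invariant for $U$.
   Context: A theory is locally finite if its signature is finite and for each finite tuple of variables there are finitely many effectively computable terms such that every term in those variables is provably equal in the theory to one of them. Fix $T_I=(\Sigma_I,\mathcal C_I)$ (sort INDEX) and $T_E=(\Sigma_E,\mathcal C_E)$ (sort ELEM). $A_I^E$ has sorts INDEX, ELEM, ARRAY, signature $\Sigma_I\cup\Sigma_E\cup\{\_[\_]\}$; its models are the three-sorted structures with INDEX-part $\mathcal M_I$ a model of $T_I$, ELEM-part $\mathcal M_E$ a model of $T_E$, ARRAY the set of all total functions INDEX$\to$ELEM, $a[i]$ function application. An $\exists^I$-formula is $\exists\underline i\,\phi(\underline i,a[\underline i])$ and a $\forall^I$-formula $\forall\underline i\,\phi(\underline i,a[\underline i])$, with $\phi(\underline i,\underline e)$ quantifier-free over $\Sigma_I\cup\Sigma_E$ and $a[\underline i]$ substituted for $\underline e$. Standing assumptions: $T_I$ is locally finite and closed under substructures; quantifier-free satisfiability modulo $T_I$ and $T_E$ is decidable. An array-based system is $\mathcal S=(a,I,\tau)$ with $I$ a $\forall^I$-formula and $\tau(a,a')$ a finite disjunction of formulae $\exists\underline i\,(\phi_L(\underline i,a[\underline i])\wedge\forall j\,a'[j]=F_G(\underline i,a[\underline i],j,a[j]))$, $\phi_L$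 quantifier-free, $F_G$ a case-defined function (defined by cases over quantifier-free conditions exhaustive and pairwise exclusive modulo the theory). $Pre(\tau,K):=\exists a'(\tau(a,a')\wedge K(a'))$, $A_I^E$-equivalent to an $\exists^I$-formula when $K$ is one. A $\forall^I$-formula $J$ is a safety invariant for $U$ if $A_I^E\models\forall a(I(a)\to J(a))$, $A_I^E\models\forall a\forall a'(J(a)\wedge\tau(a,a')\to J(a'))$, and $\exists a(U(a)\wedge J(a))$ is not $A_I^E$-satisfiable. A configuration is a pair $(s,\mathcal M)$, $\mathcal M$ a model of $A_I^E$ with finite INDEX domain, $s$ in its ARRAY domain; $s_I=\mathcal M_I$, $s_E$ the smallest $\Sigma_E$-substructure of $\mathcal M_E$ containing the image of $s$; $s'\le s$ iff there exist a $\Sigma_I$-embedding $\mu:s'_I\to s_I$ and a $\Sigma_E$-embedding $\nu:s'_E\to s_E$ with $\nu\circ s'=s\circ\mu$; $\uparrow s=\{t\mid s\le t\}$. $\widehat K$ is the set of configurations $(s,\mathcal M)$ with $\mathcal M\models K(s)$. For a configuration $s$, $K_s$ denotes an $\exists^I$-formula with $\widehat{K_s}=\uparrow s$ (such a formula exists and is effectively computable when $T_E$ is locally finite). A basis for an $\exists^I$-formula $K$ is a minimal finite set $\{s_1,\dots,s_n\}$ with $\widehat K=\uparrow s_1\cup\dots\cup\uparrow s_n$. A predecessor of a configuration $s$ is any configuration belonging to a basis for $Pre(\tau,K_s)$. A configuration $s$ is sub-reachable from a configuration $s'$ if there are configurations $s_0=s,s_1,\dots,s_n=s'$ such that for each $i=1,\dots,n$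 either $s_{i-1}\le s_i$ or $s_{i-1}$ is a predecessor of $s_i$; $s$ is sub-reachable from an $\exists^I$-formula $K$ if it is sub-reachable from some configuration in a basis of $K$. *)

(* Defs.v *)
From mathcomp Require Import all_boot.
From mathcomp Require Import boolp classical_sets cardinality.

Set Implicit Arguments.
Unset Strict Implicit.
Unset Printing Implicit Defensive.

Local Open Scope classical_set_scope.

(** * Partial recursive functions *)

Inductive murec : Type :=
| MZero
| MSucc
| MProj (i : nat)
| MComp (f : murec) (gs : seq murec)
| MPrec (f g : murec)
| MMin (f : murec).

(* [mueval c xs y]: the partial function with program [c] is defined on the
   arguments [xs] and has value [y] there. *)
Inductive mueval : murec -> seq nat -> nat -> Prop :=
| EZero xs : mueval MZero xs 0
| ESucc x : mueval MSucc [:: x] x.+1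
| EProj i xs : i < size xs -> mueval (MProj i) xs (nth 0 xs i)
| EComp f gs xs ys y :
    size ys = size gs ->
    (forall i, i < size gs -> mueval (nth MZero gs i) xs (nth 0 ys i)) ->
    mueval f ys y ->
    mueval (MComp f gs) xs y
| EPrec0 f g xs y : mueval f xs y -> mueval (MPrec f g) (0 :: xs) y
| EPrecS f g n xs r y :
    mueval (MPrec f g) (n :: xs) r ->
    mueval g [:: n, r & xs] y ->
    mueval (MPrec f g) (n.+1 :: xs) y
| EMin f xs n :
    (forall m, m < n -> exists r, mueval f (m :: xs) r.+1) ->
    mueval f (n :: xs) 0 ->
    mueval (MMin f) xs n.

Definition computable (h : nat -> nat) : Prop :=
  exists c : murec, forall n, mueval c [:: n] (h n).

(** * One-sorted signatures, terms and quantifier-free formulae *)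

Record signature := Signature {
  fsym : finType;
  farity : fsym -> nat;
  rsym : finType;
  rarity : rsym -> nat }.

Section Syntax.
Variable S : signature.

Inductive term (V : Type) : Type :=
| Var (x : V)
| App (f : fsym S) (args : 'I_(farity f) -> term V).

Inductive atom (V : Type) : Type :=
| AEq (t u : term V)
| ARel (r : rsym S) (args : 'I_(rarity r) -> term V).

End Syntax.

Inductive qform (A : Type) : Type :=
| QAtom (x : A)
| QFalse
| QNot (p : qform A)
| QAnd (p q : qform A)
| QOr (p q : qform A).

Arguments QFalse {A}.

(* Quantifier-free formulae over the union of two signatures on different
   sorts: an atom belongs to exactly one of the two signatures, and [V] is the
   type of variables of each of the two sorts. *)
Definition mixed (SI SE : signature) (V : Type) : Type :=
  qform (atom SI V + atom SE V).

(** * Goedel numbers (symbols of a finite signature are numbered by [pickle]) *)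

Fixpoint tcode (S : signature) (n : nat) (t : term S 'I_n) : nat :=
  match t with
  | Var x => CodeSeq.code [:: 0; nat_of_ord x]
  | App f args =>
      CodeSeq.code [:: 1, pickle f & [seq tcode (args i) | i <- enum 'I_(farity f)]]
  end.

Definition acode (S : signature) (n : nat) (a : atom S 'I_n) : nat :=
  match a with
  | AEq t u => CodeSeq.code [:: 0; tcode t; tcode u]
  | ARel r args =>
      CodeSeq.code [:: 1, pickle r & [seq tcode (args i) | i <- enum 'I_(rarity r)]]
  end.

Fixpoint qcode (A : Type) (code : A -> nat) (p : qform A) : nat :=
  match p with
  | QAtom x => CodeSeq.code [:: 0; code x]
  | QFalse => CodeSeq.code [:: 1]
  | QNot p => CodeSeq.code [:: 2; qcode code p]
  | QAnd p q => CodeSeq.code [:: 3; qcode code p; qcode code q]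
  | QOr p q => CodeSeq.code [:: 4; qcode code p; qcode code q]
  end.

(** * Structures *)

Record structure (S : signature) := Structure {
  dom :> Type;
  dom_inh : inhabited dom;
  fint : forall f : fsym S, ('I_(farity f) -> dom) -> dom;
  rint : forall r : rsym S, ('I_(rarity r) -> dom) -> Prop }.

Section Semantics.
Variables (S : signature) (M : structure S).

Fixpoint teval (V : Type) (v : V -> M) (t : term S V) : M :=
  match t with
  | Var x => v x
  | App f args => fint (fun i => teval v (args i))
  end.

Definition aeval (V : Type) (v : V -> M) (a : atom S V) : Prop :=
  match a with
  | AEq t u => teval v t = teval v u
  | ARel r args => rint (fun i => teval v (args i))
  end.

End Semantics.

Fixpoint qeval (A : Type) (v : A -> Prop) (p : qform A) : Prop :=
  match p with
  | QAtom x => v x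
  | QFalse => False
  | QNot p => ~ qeval v p
  | QAnd p q => qeval v p /\ qeval v q
  | QOr p q => qeval v p \/ qeval v q
  end.

Definition meval (SI SE : signature) (MI : structure SI) (ME : structure SE)
    (V : Type) (x : V -> MI) (e : V -> ME) (p : mixed SI SE V) : Prop :=
  qeval (fun a => match a with inl b => aeval x b | inr b => aeval e b end) p.

Definition is_embedding (S : signature) (M N : structure S) (h : M -> N) : Prop :=
  [/\ injective h,
      forall (f : fsym S) (xs : 'I_(farity f) -> M),
        h (fint xs) = fint (fun i => h (xs i))
    & forall (r : rsym S) (xs : 'I_(rarity r) -> M),
        rint xs <-> rint (fun i => h (xs i))].

Definition fclosed (S : signature) (M : structure S) (P : set M) : Prop :=
  forall (f : fsym S) (xs : 'I_(farity f) -> M),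
    (forall i, P (xs i)) -> P (fint xs).

Section Substructure.
Variables (S : signature) (M : structure S) (P : set M).
Hypotheses (Pne : P !=set0) (Pcl : fclosed P).

Lemma substructure_inh : inhabited {x : M | P x}.
Proof. by case: Pne => x Px; exact: (inhabits (exist _ x Px)). Qed.

Definition substructure : structure S :=
  {| dom := {x : M | P x};
     dom_inh := substructure_inh;
     fint := fun f xs =>
       exist P (fint (fun i => sval (xs i))) (Pcl (fun i => svalP (xs i)));
     rint := fun r xs => rint (fun i => sval (xs i)) |}.

End Substructure.

Definition generated (S : signature) (M : structure S) (X : set M) : set M :=
  [set x | forall P : set M, fclosed P -> X `<=` P -> P x].

Lemma sub_generated (S : signature) (M : structure S) (X : set M) :
  X `<=` generated X.
Proof. by move=> x Xx P _; apply. Qed.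

Lemma generated_closed (S : signature) (M : structure S) (X : set M) :
  fclosed (generated X).
Proof. by move=> f xs Xxs P Pcl XP; apply: (Pcl) => i; apply: (Xxs i). Qed.

(** * Theories, given by their classes of models *)

Definition theory (S : signature) : Type := structure S -> Prop.

(* Finiteness of the signature is built into [signature]. *)
Definition locally_finite (S : signature) (T : theory S) : Prop :=
  exists ts : forall n : nat, seq (term S 'I_n),
    computable (fun n => CodeSeq.code [seq tcode t | t <- ts n]) /\
    forall (n : nat) (u : term S 'I_n),
      exists2 k : nat, k < size (ts n) &
        forall M : structure S, T M ->
        forall v : 'I_n -> M, teval v u = teval v (nth u (ts n) k).

Definition closed_under_substructures (S : signature) (T : theory S) : Prop :=
  forall (M : structure S) (P : set M) (Pne : P !=set0) (Pcl : fclosed P),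
    T M -> T (substructure Pne Pcl).

Definition qf_satisfiable (S : signature) (T : theory S) (n : nat)
    (p : qform (atom S 'I_n)) : Prop :=
  exists M : structure S, T M /\ exists v : 'I_n -> M, qeval (aeval v) p.

Definition qf_sat_decidable (S : signature) (T : theory S) : Prop :=
  exists2 chi : nat -> nat, computable chi &
    forall (n : nat) (p : qform (atom S 'I_n)),
      chi (CodeSeq.code [:: n; qcode (@acode S n) p]) = 1 <-> qf_satisfiable T p.

(** * The theory of arrays over [TI] (indexes) and [TE] (elements) *)

(* An [iformula] is the matrix phi(i, e) of an exists^I- or forall^I-formula,
   where i and e are tuples of the same length; which of the two formulae is
   meant is fixed by the interpretation, [exI] or [allI]. *)
Record iformula (SI SE : signature) := IFormula {
  ilen : nat;
  imatrix : mixed SI SE 'I_ilen }.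

Section Arrays.
Variables (SI SE : signature) (TI : theory SI) (TE : theory SE).

Record model := Model {
  idx : structure SI;
  elm : structure SE;
  idx_model : TI idx;
  elm_model : TE elm }.

Definition array (M : model) : Type := idx M -> elm M.

(* Formulae with one free array variable, up to equivalence modulo the theory
   of arrays. *)
Definition array_pred : Type := forall M : model, array M -> Prop.

Definition exI (K : iformula SI SE) : array_pred := fun M a =>
  exists i : 'I_(ilen K) -> idx M, meval i (fun k => a (i k)) (imatrix K).

Definition allI (K : iformula SI SE) : array_pred := fun M a =>
  forall i : 'I_(ilen K) -> idx M, meval i (fun k => a (i k)) (imatrix K).

Definition is_allI (J : array_pred) : Prop :=
  exists K : iformula SI SE, forall (M : model) (a : array M), J M a <-> allI K a.

(** * Array-based systems *)

(* A function F(i, e, j, e') for tuples i, e of length n: the variables i, j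
   (resp. e, e') are indexed by [option 'I_n], with [None] standing for j
   (resp. e').  The terms giving the values only involve [SE], since this is
   the only signature with symbols of range sort ELEM. *)
Record case_fun (n : nat) := CaseFun {
  ncase : nat;
  ccond : 'I_ncase -> mixed SI SE (option 'I_n);
  cterm : 'I_ncase -> term SE (option 'I_n);
  case_exhaustive : forall (M : model)
      (x : option 'I_n -> idx M) (e : option 'I_n -> elm M),
    exists c, meval x e (ccond c);
  case_exclusive : forall (M : model)
      (x : option 'I_n -> idx M) (e : option 'I_n -> elm M) c d,
    c <> d -> ~ (meval x e (ccond c) /\ meval x e (ccond d)) }.

Definition case_value (n : nat) (F : case_fun n) (M : model)
    (x : option 'I_n -> idx M) (e : option 'I_n -> elm M) (y : elm M) : Prop :=
  forall c : 'I_(ncase F), meval x e (ccond c) -> y = teval e (cterm c).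

Record transition := Transition {
  tlen : nat;
  guard : mixed SI SE 'I_tlen;
  update : case_fun tlen }.

Definition fires (t : transition) (M : model) (a a' : array M) : Prop :=
  exists i : 'I_(tlen t) -> idx M,
    meval i (fun k => a (i k)) (guard t) /\
    forall j : idx M,
      case_value (update t) (oapp i j) (oapp (fun k => a (i k)) (a j)) (a' j).

Record array_system := ArraySystem {
  init : iformula SI SE;
  ntrans : nat;
  trans : 'I_ntrans -> transition }.

Definition step (Sys : array_system) (M : model) (a a' : array M) : Prop :=
  exists r : 'I_(ntrans Sys), fires (trans r) a a'.

Definition Pre (Sys : array_system) (K : array_pred) : array_pred := fun M a =>
  exists a' : array M, step Sys a a' /\ K M a'.

Definition safety_invariant (Sys : array_system) (U : iformula SI SE)
    (J : array_pred) : Prop :=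
  [/\ is_allI J,
      forall (M : model) (a : array M), allI (init Sys) a -> J M a,
      forall (M : model) (a a' : array M), J M a /\ step Sys a a' -> J M a'
    & ~ exists (M : model) (a : array M), exI U a /\ J M a].

(** * Configurations *)

Record configuration := Configuration {
  cmodel : model;
  cfinite : finite_set [set: idx cmodel];
  carr : array cmodel }.

Lemma range_carr_neq0 (s : configuration) : generated (range (@carr s)) !=set0.
Proof.
by case: (dom_inh (idx (cmodel s))) => i; exists (carr i); apply: sub_generated; exists i.
Qed.

Definition conf_idx (s : configuration) : structure SI := idx (cmodel s).

Definition conf_elm (s : configuration) : structure SE :=
  substructure (range_carr_neq0 s) (@generated_closed SE _ (range (@carr s))).

Definition conf_fun (s : configuration) (i : conf_idx s) : conf_elm s :=
  exist _ (@carr s i) (@sub_generated SE _ (range (@carr s)) _ (imageT _ i)).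

Definition conf_le (s' s : configuration) : Prop :=
  exists (mu : conf_idx s' -> conf_idx s) (nu : conf_elm s' -> conf_elm s),
    [/\ is_embedding mu, is_embedding nu
      & forall i, nu (conf_fun i) = conf_fun (mu i)].

Definition up (s : configuration) : set configuration := [set t | conf_le s t].

Definition hat (K : array_pred) : set configuration :=
  [set s | K (cmodel s) (@carr s)].

(* [K] is a possible choice for the formula K_s. *)
Definition is_K_of (s : configuration) (K : iformula SI SE) : Prop :=
  hat (exI K) = up s.

Definition generates (B : set configuration) (K : array_pred) : Prop :=
  hat K = \bigcup_(s in B) up s.

Definition is_basis (K : array_pred) (B : set configuration) : Prop :=
  [/\ finite_set B, generates B K
    & forall B', B' `<=` B -> generates B' K -> B' = B].

Definition predecessor (Sys : array_system) (p s : configuration) : Prop :=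
  exists (K : iformula SI SE) (B : set configuration),
    [/\ is_K_of s K, is_basis (Pre Sys (exI K)) B & B p].

Definition sub_reachable (Sys : array_system) (s s' : configuration) : Prop :=
  exists (n : nat) (c : nat -> configuration),
    [/\ c 0 = s, c n = s'
      & forall i, i < n -> conf_le (c i) (c i.+1) \/ predecessor Sys (c i) (c i.+1)].

Definition sub_reachable_from (Sys : array_system) (s : configuration)
    (K : iformula SI SE) : Prop :=
  exists (B : set configuration) (s' : configuration),
    [/\ is_basis (exI K) B, B s' & sub_reachable Sys s s'].

Definition neg_disj (k : nat) (K : 'I_k -> iformula SI SE) : array_pred :=
  fun M a => ~ exists i : 'I_k, exI (K i) a.

End Arrays.

(* Main.v *)
Require Import Defs.
From mathcomp Require Import all_boot.
From mathcomp Require Import boolp classical_sets cardinality.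

(** Let [H] be the negation of the given safety invariant, an exists^I-formula
    that contains [U], is closed under [Pre] and is disjoint from the initial
    states.  By local finiteness [H] is generated by finitely many
    configurations; keep those that are sub-reachable from [U].  Every basis
    element of [U], and every predecessor of a kept configuration, satisfies
    [H], hence lies above some generator of [H], which is then itself
    sub-reachable.  So the upward closure of the kept generators contains [U]
    and is closed under [Pre], and it is disjoint from the initial states as a
    part of [H].

    Inclusions between formulae are checked on configurations only: finitely
    many witnesses generate a finite index substructure, to which truth
    restricts.  Finite generation holds because a configuration whose index
    part is enumerated by [N] variables is determined, up to mutual embedding,
    by the truth values of finitely many atoms. *)

Set Implicit Arguments.
Unset Strict Implicit.
Unset Printing Implicit Defensive.

Local Open Scope classical_set_scope.

(** * Finite conjunctions and literals *)

Section Formulae.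
Variables (A : Type) (v : A -> Prop).

Lemma qeval_ext (w : A -> Prop) (p : qform A) :
  (forall a, v a <-> w a) -> qeval v p <-> qeval w p.
Proof.
by move=> vw; have -> : v = w by apply/funext => a; apply/propext.
Qed.

Definition qconj (I : finType) (F : I -> qform A) : qform A :=
  foldr (fun i p => QAnd (F i) p) (QNot QFalse) (enum I).

Lemma qeval_conj (I : finType) (F : I -> qform A) :
  qeval v (qconj F) <-> forall i, qeval v (F i).
Proof.
suff H l : qeval v (foldr (fun i p => QAnd (F i) p) (QNot QFalse) l) <->
    forall i, i \in l -> qeval v (F i).
  rewrite /qconj H; split=> FP i; last by move=> _; exact: FP.
  by apply: FP; rewrite mem_enum.
elim: l => [|j l IH] /=; first by split=> // _; apply.
rewrite IH; split=> [[Fj Fl] i|FP].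
  by rewrite inE => /predU1P[->//|]; exact: Fl.
by split=> [|i il]; apply: FP; rewrite inE ?eqxx ?il ?orbT.
Qed.

(** Records the truth value of [P] as the sign of a literal on [a]; conjunctions of such literals
    spell out diagrams of structures. *)
Definition qlit (P : Prop) (a : A) : qform A :=
  if `[< P >] then QAtom a else QNot (QAtom a).

Lemma qeval_lit (P : Prop) (a : A) : qeval v (qlit P a) <-> (P <-> v a).
Proof. by rewrite /qlit; case: asboolP => /= HP; tauto. Qed.

End Formulae.

(** * Renaming of variables *)

Fixpoint qmap (A B : Type) (f : A -> B) (p : qform A) : qform B :=
  match p with
  | QAtom x => QAtom (f x)
  | QFalse => QFalse
  | QNot p => QNot (qmap f p)
  | QAnd p q => QAnd (qmap f p) (qmap f q)
  | QOr p q => QOr (qmap f p) (qmap f q)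
  end.

Lemma qeval_map (A B : Type) (f : A -> B) (v : B -> Prop) (p : qform A) :
  qeval v (qmap f p) = qeval (fun a => v (f a)) p.
Proof. by elim: p => //= [p ->|p -> q ->|p -> q ->]. Qed.

Section Renaming.
Variables (S : signature) (V W : Type) (f : V -> W).

Fixpoint trename (t : term S V) : term S W :=
  match t with
  | Var x => Var S (f x)
  | App g args => App (fun i => trename (args i))
  end.

Definition arename (a : atom S V) : atom S W :=
  match a with
  | AEq t u => AEq (trename t) (trename u)
  | ARel r args => ARel (fun i => trename (args i))
  end.

Lemma teval_rename (M : structure S) (v : W -> M) (t : term S V) :
  teval v (trename t) = teval (fun x => v (f x)) t.
Proof. by elim: t => //= g args IH; congr fint; apply/funext. Qed.

Lemma aeval_rename (M : structure S) (v : W -> M) (a : atom S V) :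
  aeval v (arename a) = aeval (fun x => v (f x)) a.
Proof.
case: a => [t u|r args] /=; first by rewrite !teval_rename.
by congr rint; apply/funext => i; exact: teval_rename.
Qed.

End Renaming.

Definition mrename (SI SE : signature) (V W : Type) (f : V -> W)
    (p : mixed SI SE V) : mixed SI SE W :=
  qmap (fun a => match a with
    | inl b => inl (arename f b)
    | inr b => inr (arename f b) end) p.

Lemma meval_rename (SI SE : signature) (MI : structure SI) (ME : structure SE)
    (V W : Type) (f : V -> W) (x : W -> MI) (e : W -> ME) (p : mixed SI SE V) :
  meval x e (mrename f p) <-> meval (fun v => x (f v)) (fun v => e (f v)) p.
Proof.
rewrite /meval /mrename qeval_map.
by apply: qeval_ext => -[] a; rewrite aeval_rename.
Qed.

(** * Embeddings, diagrams and local finiteness *)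

Section Embeddings.
Variable S : signature.
Implicit Types M N : structure S.

Lemma teval_embedding M N (h : M -> N) (V : Type) (v : V -> M) (t : term S V) :
  is_embedding h -> h (teval v t) = teval (fun x => h (v x)) t.
Proof.
move=> [_ hf _]; elim: t => //= f args IH.
by rewrite hf; congr fint; apply/funext.
Qed.

Lemma aeval_embedding M N (h : M -> N) (V : Type) (v : V -> M) (a : atom S V) :
  is_embedding h -> aeval v a <-> aeval (fun x => h (v x)) a.
Proof.
move=> eh; have [hI _ hr] := eh; case: a => [t u|r args] /=.
  by rewrite -!(teval_embedding _ _ eh); split=> [->|/hI].
rewrite hr; set xs := (X in rint X <-> _); set ys := (X in _ <-> rint X).
suff -> : xs = ys by [].
by apply/funext => i; exact: teval_embedding.
Qed.

Lemma id_embedding M : is_embedding (fun x : M => x).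
Proof. by split. Qed.

Lemma sval_embedding M (P : set M) (Pne : P !=set0) (Pcl : Defs.fclosed P) :
  is_embedding (sval : substructure Pne Pcl -> M).
Proof.
split=> // -[x Px] [y Py] /= xy; subst y.
by congr exist; exact: Prop_irrelevance.
Qed.

Lemma generated_teval M (V : Type) (x : V -> M) (z : M) :
  generated (range x) z -> exists t : term S V, z = teval x t.
Proof.
move=> /(_ [set z | exists t : term S V, z = teval x t]); apply.
  move=> f xs /choice[ts xsE]; exists (App ts) => /=.
  by congr fint; apply/funext.
by move=> _ [v _ <-]; exists (Var S v).
Qed.

Lemma fclosed_teval M (P : set M) (V : Type) (x : V -> M) (t : term S V) :
  Defs.fclosed P -> (forall v, P (x v)) -> P (teval x t).
Proof. by move=> Pcl Px; elim: t => //= f args IH; exact: Pcl. Qed.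

(** The method of diagrams: name each element of [M] by a term and send it to the value of that term
    under [y]. Equality atoms make this independent of the name, injective and compatible with
    functions; the other atoms handle relations. *)
Lemma embedding_of_atoms M N (V : Type) (x : V -> M) (y : V -> N) :
    (forall z, exists t : term S V, z = teval x t) ->
    (forall a : atom S V, aeval x a <-> aeval y a) ->
  exists2 h : M -> N, is_embedding h & forall v, h (x v) = y v.
Proof.
move=> /choice[g gE] xy; pose h z := teval y (g z).
have hE t : h (teval x t) = teval y t.
  by apply/(xy (AEq (g (teval x t)) t)); rewrite /= -gE.
exists h; last by move=> v; exact: (hE (Var S v)).
split=> [z z'|f xs|r xs].
- by move=> /(xy (AEq (g z) (g z'))) /=; rewrite -!gE.
- apply: etrans (hE (App (fun i => g (xs i)))); congr (h (fint _)).
  by apply/funext => i; exact: gE.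
- have {1}-> : xs = fun i => teval x (g (xs i)).
    by apply/funext => i; exact: gE.
  exact: (xy (ARel (fun i => g (xs i)))).
Qed.

Lemma locally_finite_atoms (T : theory S) (n : nat) : locally_finite T ->
  exists (A : finType) (at_ : A -> atom S 'I_n),
    forall a : atom S 'I_n, exists k : A,
      forall M, T M -> forall v : 'I_n -> M, aeval v a <-> aeval v (at_ k).
Proof.
move=> [ts [_ tsP]].
have rep u : exists k : 'I_(size (ts n)), forall M, T M -> forall v : 'I_n -> M,
    teval v u = teval v (tnth (in_tuple (ts n)) k).
  have [k kn uE] := tsP n u; exists (Ordinal kn) => M TM v.
  by rewrite uE // (tnth_nth u).
pose tt_ k := tnth (in_tuple (ts n)) k.
pose I := 'I_(size (ts n)).
(* Atoms over representative terms: a pair of terms for an equation, or a relation symbol with a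
   tuple of terms. *)
exists ((I * I) + {r : rsym S & {ffun 'I_(rarity r) -> I}})%type.
exists (fun k : I * I + {r : rsym S & {ffun 'I_(rarity r) -> I}} => match k with
  | inl kl => AEq (tt_ kl.1) (tt_ kl.2)
  | inr (existT r k) => @ARel S _ r (fun i => tt_ (k i)) end).
case=> [t u|r args].
  have [k kE] := rep t; have [l lE] := rep u; exists (inl (k, l)) => M TM v /=.
  by rewrite (kE M TM) (lE M TM).
have [k kE] := choice (fun i => rep (args i)).
exists (inr (Tagged (fun r => {ffun 'I_(rarity r) -> I}) [ffun i => k i])) => M TM v /=.
set xs := (X in rint X <-> _); set ys := (X in _ <-> rint X).
suff -> : xs = ys by [].
by apply/funext => i; rewrite /xs /ys ffunE; exact: kE.
Qed.

(** A generated substructure consists of the values of the representative terms, so the bound [N] is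
    the same for all models. *)
Lemma locally_finite_generated (T : theory S) (n : nat) : locally_finite T ->
  exists N : nat, forall M, T M -> forall x : 'I_n -> M,
    exists f : 'I_N -> M, generated (range x) = range f.
Proof.
move=> [ts [_ tsP]]; exists (size (ts n)) => M TM x.
exists (fun k => teval x (tnth (in_tuple (ts n)) k)).
apply/seteqP; split=> [z /generated_teval[u ->]|_ [k _ <-]].
  have [k kn uE] := tsP n u; exists (Ordinal kn) => //.
  by rewrite uE // (tnth_nth u).
apply: (@fclosed_teval _ (generated (range x))) => [|v]; first exact: generated_closed.
by apply: sub_generated; exists v.
Qed.

End Embeddings.

(** * The order on configurations and the formulae K_s *)

Section Configurations.
Variables (SI SE : signature) (TI : theory SI) (TE : theory SE).
Hypotheses (TI_lf : locally_finite TI) (TI_sub : closed_under_substructures TI).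
Hypothesis TE_lf : locally_finite TE.

Notation model := (model TI TE).
Notation configuration := (configuration TI TE).
Notation array_pred := (array_pred TI TE).
Implicit Types (M : model) (s t : configuration) (K H U : iformula SI SE).

Lemma meval_ext (V : Type) (MI NI : structure SI) (ME NE : structure SE)
    (x : V -> MI) (y : V -> NI) (d : V -> ME) (e : V -> NE) (p : mixed SI SE V) :
    (forall a, aeval x a <-> aeval y a) -> (forall a, aeval d a <-> aeval e a) ->
  meval x d p <-> meval y e p.
Proof. by move=> xy de; apply: qeval_ext => -[]. Qed.

Lemma conf_elm_embedding s :
  is_embedding (sval : conf_elm s -> elm (cmodel s)).
Proof. exact: sval_embedding. Qed.

(** The method of diagrams in each sort: since [x] is onto, the values [carr (x v)] generate
    [conf_elm s], so terms in them name all its elements. *)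
Lemma conf_le_of_atoms s t (V : Type) (x : V -> conf_idx s) (y : V -> conf_idx t) :
    (forall i, exists v, x v = i) ->
    (forall a, aeval x a <-> aeval y a) ->
    (forall a, aeval (fun v => carr (x v)) a <-> aeval (fun v => carr (y v)) a) ->
  conf_le s t.
Proof.
move=> x_surj xyI xyE.
have [mu mu_emb muE] : exists2 h, is_embedding h & forall v, h (x v) = y v.
  by apply: embedding_of_atoms => // i; have [v <-] := x_surj i; exists (Var SI v).
have [nu nu_emb nuE] : exists2 h : conf_elm s -> conf_elm t, is_embedding h &
    forall v, h (conf_fun (x v)) = conf_fun (y v).
  apply: embedding_of_atoms => [z|a]; last first.
    by rewrite !(aeval_embedding _ _ (conf_elm_embedding _)); exact: xyE.
  have [] := @generated_teval _ _ _ (fun v => carr (x v)) (sval z).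
    move=> P Pcl xP; case: z => z /= gz; apply: gz => // _ [i _ <-].
    by have [v <-] := x_surj i; apply: xP; exists v.
  move=> u zE; exists u; have [sI _ _] := conf_elm_embedding s.
  by apply: sI; rewrite (teval_embedding _ _ (conf_elm_embedding _)).
exists mu, nu; split=> // i; have [v <-] := x_surj i.
by rewrite nuE muE.
Qed.

Lemma conf_le_refl s : conf_le s s.
Proof. by exists (fun i => i), (fun e => e); split=> //; exact: id_embedding. Qed.

Lemma conf_le_meval s t (mu : conf_idx s -> conf_idx t) (nu : conf_elm s -> conf_elm t)
    (V : Type) (x : V -> conf_idx s) (e : V -> conf_elm s) (p : mixed SI SE V) :
    is_embedding mu -> is_embedding nu ->
  meval x (fun v => sval (e v)) p <->
  meval (fun v => mu (x v)) (fun v => sval (nu (e v))) p.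
Proof.
move=> mu_emb nu_emb; apply: meval_ext => a; first exact: aeval_embedding.
rewrite -(aeval_embedding _ _ (conf_elm_embedding s)) (aeval_embedding _ _ nu_emb).
exact: (aeval_embedding _ _ (conf_elm_embedding t)).
Qed.

Definition up_closed (K : array_pred) : Prop :=
  forall s t, conf_le s t -> hat K s -> hat K t.

Lemma up_closed_exI K : up_closed (exI K).
Proof.
move=> s t [mu [nu [mu_emb nu_emb munu]]] [i Ki]; exists (fun k => mu (i k)).
move/(@conf_le_meval s t mu nu _ i (fun k => conf_fun (i k)) _ mu_emb nu_emb): Ki.
by apply: (iffLR (meval_ext _ _ _)) => // a; under eq_fun do rewrite munu.
Qed.

(** The matrix is the diagram of [s] in both sorts, for an enumeration [f] of its indexes; by local
    finiteness finitely many atoms suffice. *)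
Lemma exists_K_of s : exists K, is_K_of s K.
Proof.
have [n [f fP]] : exists n (f : 'I_n -> conf_idx s), forall i, exists k, f k = i.
  have /finite_setP[n] := cfinite s.
  move=> /(card_eq_trans)/(_ card_II)/card_bijP[g [h gh hg]].
  exists n, (fun k => val (h (functions.to_setT k))) => i; exists (val (g (functions.to_setT i))).
  by rewrite (_ : functions.to_setT _ = g (functions.to_setT i)) ?gh //; exact: val_inj.
have [AI [atI atIP]] := locally_finite_atoms n TI_lf.
have [AE [atE atEP]] := locally_finite_atoms n TE_lf.
pose e k := carr (f k).
exists (IFormula (QAnd (qconj (fun k => qlit (aeval f (atI k)) (inl (atI k))))
                       (qconj (fun k => qlit (aeval e (atE k)) (inr (atE k)))))).
apply/seteqP; split=> t /=.
  move=> [y [/qeval_conj yI /qeval_conj yE]].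
  apply: (conf_le_of_atoms fP (y := y)) => a.
    have [k kP] := atIP a; rewrite (kP _ (idx_model _)) (kP _ (idx_model _)).
    by have /qeval_lit := yI k.
  have [k kP] := atEP a; rewrite (kP _ (elm_model _)) (kP _ (elm_model _)).
  by have /qeval_lit := yE k.
move=> st; apply: (up_closed_exI st); exists f.
by split; apply/qeval_conj => k; apply/qeval_lit.
Qed.


(** * Restriction to index substructures *)

Definition restrict M (P : set (idx M)) (Pne : P !=set0) (Pcl : Defs.fclosed P) : model :=
  Model (TI_sub Pne Pcl (idx_model M)) (elm_model M).

Definition restrict_arr M (P : set (idx M)) (Pne : P !=set0) (Pcl : Defs.fclosed P)
    (a : array M) : array (restrict Pne Pcl) := fun i => a (sval i).
Arguments restrict_arr {M P} Pne Pcl a.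

Lemma meval_restrict M (P : set (idx M)) (Pne : P !=set0) (Pcl : Defs.fclosed P)
    (V : Type) (x : V -> substructure Pne Pcl) (e : V -> elm M) (p : mixed SI SE V) :
  meval x e p <-> meval (fun v => sval (x v)) e p.
Proof. by apply: meval_ext => // a; apply: aeval_embedding; exact: sval_embedding. Qed.

Lemma exI_restrict K M (P : set (idx M)) (Pne : P !=set0) (Pcl : Defs.fclosed P)
    (a : array M) :
  exI K (restrict_arr Pne Pcl a) -> exI K a.
Proof. by move=> [i /meval_restrict Ki]; exists (fun k => sval (i k)). Qed.

(* The truth of [K] is witnessed by at most [n] indexes, in the sense that it
   is inherited by every restriction that keeps them. *)
Definition local (n : nat) (K : array_pred) : Prop :=
  forall M (a : array M), K M a ->
  exists (V : finType) (x : V -> idx M), #|V| <= n /\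
    forall (P : set (idx M)) (Pne : P !=set0) (Pcl : Defs.fclosed P),
      (forall v, P (x v)) -> K _ (restrict_arr Pne Pcl a).

Lemma local_exI K : local (ilen K) (exI K).
Proof.
move=> M a [i Ki]; exists 'I_(ilen K), i; split; first by rewrite card_ord.
move=> P Pne Pcl Pi; exists (fun k => exist P (i k) (Pi k)).
exact/meval_restrict.
Qed.

(** The witnesses are the indexes of the fired transition together with those of [K] in the
    successor array, whose restriction is again a successor. *)
Lemma local_Pre (Sys : array_system TI TE) K :
  local (\max_r tlen (@trans _ _ _ _ Sys r) + ilen K) (Pre Sys (exI K)).
Proof.
move=> M a [b [[r [i [gi ui]]] [j Kj]]].
exists ('I_(tlen (trans r)) + 'I_(ilen K))%type.
exists (fun v => match v with inl k => i k | inr k => j k end); split.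
  by rewrite card_sum !card_ord leq_add2r (leq_bigmax r).
move=> P Pne Pcl Pij.
have Pi k : P (i k) := Pij (inl k); have Pj k : P (j k) := Pij (inr k).
exists (restrict_arr Pne Pcl b); split; last first.
  by exists (fun k => exist P (j k) (Pj k)); exact/meval_restrict.
exists r, (fun k => exist P (i k) (Pi k)); split; first exact/meval_restrict.
move=> l c cl; apply: (ui (sval l)); move/meval_restrict: cl.
apply: (iffLR (meval_ext _ _ _)) => // d.
suff -> : (fun v => sval (oapp (fun k => exist P (i k) (Pi k)) l v)) = oapp i (sval l) by [].
by apply/funext; case.
Qed.

Lemma local_finite (n : nat) : exists N, forall K : array_pred, local n K ->
  forall M (a : array M), K M a ->
  exists (P : set (idx M)) (Pne : P !=set0) (Pcl : Defs.fclosed P),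
    (exists f : 'I_N -> idx (restrict Pne Pcl), forall i, exists k, f k = i) /\
    K _ (restrict_arr Pne Pcl a).
Proof.
have [N NP] := locally_finite_generated n.+1 TI_lf.
exists N => K Kloc M a /Kloc[V [x [Vn xP]]].
have [x0] := dom_inh (idx M).
pose y (k : 'I_n.+1) := oapp (fun j : 'I_#|V| => x (enum_val j)) x0 (insub (val k)).
have yx v : exists k, y k = x v.
  exists (widen_ord (leqW Vn) (enum_rank v)).
  rewrite /y /= insubT ?ltn_ord // => lt_v /=.
  rewrite -[in RHS](enum_rankK v); congr (x (enum_val _)); exact: val_inj.
have [f fE] := NP _ (idx_model M) y.
have Pne : generated (range y) !=set0.
  by exists (y ord0); apply: sub_generated; exists ord0.
exists (generated (range y)), Pne, (@generated_closed _ _ _); split; last first.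
  by apply: xP => v; have [k <-] := yx v; apply: sub_generated; exists k.
have Pf k : generated (range y) (f k) by rewrite fE; exists k.
exists (fun k => exist _ (f k) (Pf k)) => -[i Pi].
have := Pi; rewrite {1}fE => -[k _ fk]; exists k.
by case: _ / fk in Pi *; congr exist; exact: Prop_irrelevance.
Qed.

(** * Finite generation and bases *)

Lemma surj_finite (N : nat) (T : Type) (f : 'I_N -> T) :
  (forall i, exists k, f k = i) -> finite_set [set: T].
Proof.
move=> fP; rewrite (_ : setT = range f); last first.
  by apply/seteqP; split=> // i _; have [k <-] := fP i; exists k.
exact/finite_image/finite_finset.
Qed.

(** Restricting to the witnesses of [K] gives a configuration, where [H] holds by assumption; an
    existential formula then passes back to the larger index part. *)
Lemma local_subset (n : nat) (K : array_pred) H : local n K ->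
  hat K `<=` hat (exI H) -> forall M (a : array M), K M a -> exI H a.
Proof.
move=> Kloc KH M a; have [N NP] := local_finite n.
move=> /(NP _ Kloc)[P [Pne [Pcl [[f fP] Ka]]]].
apply: (exI_restrict (Pne := Pne) (Pcl := Pcl)).
exact: (KH (Configuration (surj_finite fP) (restrict_arr Pne Pcl a))).
Qed.

Lemma local_generates (n : nat) (K : array_pred) : local n K -> up_closed K ->
  exists (m : nat) (f : 'I_m -> configuration), generates (range f) K.
Proof.
move=> Kloc Kup; have [N NP] := local_finite n.
have [AI [atI atIP]] := locally_finite_atoms N TI_lf.
have [AE [atE atEP]] := locally_finite_atoms N TE_lf.
(* Truth tables of the representative atoms; one configuration is chosen for each table realized by
   an [N]-enumerated configuration satisfying [K]. *)
pose D : finType := ({ffun AI -> bool} * {ffun AE -> bool})%type.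
pose diag s (x : 'I_N -> conf_idx s) : D :=
  ([ffun k => `[< aeval x (atI k) >]],
   [ffun k => `[< aeval (fun v => carr (x v)) (atE k) >]]).
pose good (d : D) s := hat K s /\
  exists2 x : 'I_N -> conf_idx s, forall i, exists k, x k = i & diag s x = d.
pose E := [set d | `[< exists s, good d s >]]%SET.
have /choice[f fP] (i : 'I_#|E|) : exists s, good (enum_val i) s.
  by have := enum_valP i; rewrite inE => /asboolP.
exists #|E|, f; apply/seteqP; split=> [t Kt|t [_ [i _ <-]]]; last first.
  by have [Ki _] := fP i; move=> it; exact: (Kup _ _ it Ki).
have [P [Pne [Pcl [[x xP] Ka]]]] := NP _ Kloc _ _ Kt.
pose s := Configuration (surj_finite xP) (restrict_arr Pne Pcl (@carr _ _ _ _ t)).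
have dE : diag s x \in E.
  by rewrite inE; apply/asboolP; exists s; split=> //; exists x.
pose i := enum_rank_in dE (diag s x).
have [_ [y yP]] := fP i; rewrite enum_rankK_in // => -[/ffunP dI /ffunP dEE].
exists (f i); first by exists i.
pose z v := sval (x v).
apply: (conf_le_of_atoms yP (y := z)) => a.
  have [k kP] := atIP a.
  have := dI k; rewrite !ffunE => e; have dIk := asbool_eq_equiv e.
  rewrite (kP _ (idx_model _) y) dIk -(kP _ (idx_model (cmodel s)) x).
  exact: (aeval_embedding x a (sval_embedding Pne Pcl)).
have [k kP] := atEP a; rewrite (kP _ (elm_model _)) (kP _ (elm_model _)).
by have := dEE k; rewrite !ffunE => e; exact: asbool_eq_equiv e.
Qed.

(** Minimality is arranged among sets of positions in a finite generating family; a generating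
    subset of the image pulls back to such a set. *)
Lemma local_basis (n : nat) (K : array_pred) : local n K -> up_closed K ->
  exists B, is_basis K B.
Proof.
move=> Kloc Kup; have [m [f fK]] := local_generates Kloc Kup.
pose gen (A : {set 'I_m}) := `[< generates (f @` [set` A]) K >].
have /minset_exists[A /minsetP[/asboolP AK Amin] _] : gen [set: 'I_m]%SET.
  apply/asboolP; rewrite (_ : [set` _] = setT) //.
  by apply/seteqP; split=> // i _ /=; rewrite inE.
exists (f @` [set` A]); split=> //; first exact/finite_image/finite_finset.
move=> B' B'A B'K.
pose A' := [set i in A | `[< B' (f i) >]]%SET.
have A'E : f @` [set` A'] = B'.
  apply/seteqP; split=> [_ [i /= + <-]|s B's].
    by rewrite inE => /andP[_ /asboolP].
  have [i iA fi] := B'A _ B's; exists i => //=.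
  by rewrite inE iA; apply/asboolP; rewrite fi.
rewrite -A'E (Amin A') //; first by apply/asboolP; rewrite A'E.
by apply/fintype.subsetP => i; rewrite inE => /andP[].
Qed.


(** * Upward closure of [Pre] *)

Lemma exists_case_value (n : nat) (F : case_fun TI TE n) M
    (x : option 'I_n -> idx M) (e : option 'I_n -> elm M) :
  exists y, case_value F x e y.
Proof.
have [c Fc] := case_exhaustive F x e; exists (teval e (cterm c)) => d Fd.
have [->//|/eqP cd] := eqVneq c d.
by case: (case_exclusive cd (conj Fc Fd)).
Qed.

(* The new array takes its values in the substructure generated by the old
   one, so the step transfers along the embeddings even though that
   substructure need not be a model of [TE]. *)
Lemma up_closed_Pre (Sys : array_system TI TE) K : up_closed (Pre Sys (exI K)).
Proof.
move=> s t [mu [nu [mu_emb nu_emb munu]]] [b [[r [i [gi ui]]] [w Kw]]].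
have conf_meval (V : Type) (x : V -> conf_idx s) (e : V -> conf_elm s) p :=
  @conf_le_meval s t mu nu V x e p mu_emb nu_emb.
have /choice[b' b'P] (j : conf_idx t) := exists_case_value (update (trans r))
  (oapp (fun k => mu (i k)) j) (oapp (fun k => carr (mu (i k))) (carr j)).
have /choice[z zP] (j : conf_idx s) : exists z : conf_elm s,
    b j = sval z /\ b' (mu j) = sval (nu z).
  pose x := oapp i j; pose e := oapp (fun k => conf_fun (i k)) (conf_fun j).
  have eE : (fun v => sval (e v)) = oapp (fun k => carr (i k)) (carr j).
    by apply/funext; case.
  have xE : (fun v => mu (x v)) = oapp (fun k => mu (i k)) (mu j).
    by apply/funext; case.
  have nuE : (fun v => sval (nu (e v))) = oapp (fun k => carr (mu (i k))) (carr (mu j)).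
    by apply/funext; case=> [k|]; rewrite /e /= munu.
  (* The case that applies at [j] also applies at [mu j], so both new values come from the same term
     [cterm c]. *)
  have [c cP] := case_exhaustive (update (trans r)) x (fun v => sval (e v)).
  exists (teval e (cterm c)).
  rewrite (teval_embedding _ _ nu_emb) !(teval_embedding _ _ (conf_elm_embedding _)).
  rewrite nuE eE; split; first by apply: ui; rewrite -eE.
  by apply: b'P; rewrite -xE -nuE; apply/conf_meval.
exists b'; split.
  exists r, (fun k => mu (i k)); split=> //.
  move/(conf_meval _ i (fun k => conf_fun (i k))): gi.
  by under [fun v => sval _]eq_fun do rewrite munu.
exists (fun k => mu (w k)).
have bw : (fun k => b (w k)) = fun k => sval (z (w k)).
  by apply/funext => k; have [] := zP (w k).
have b'w : (fun k => b' (mu (w k))) = fun k => sval (nu (z (w k))).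
  by apply/funext => k; have [] := zP (w k).
by rewrite b'w; apply/conf_meval; rewrite -bw.
Qed.

(** * Boolean operations on formulae *)

Lemma exI_or K H : exists D : iformula SI SE,
  forall M (a : array M), exI D a <-> exI K a \/ exI H a.
Proof.
exists (IFormula (QOr (mrename (@lshift (ilen K) (ilen H)) (imatrix K))
                      (mrename (@rshift (ilen K) (ilen H)) (imatrix H)))) => M a.
have [x0] := dom_inh (idx M); split.
  move=> [i []] /meval_rename Ki.
    by left; exists (fun v => i (lshift (ilen H) v)).
  by right; exists (fun v => i (rshift (ilen K) v)).
move=> [[i Ki]|[i Hi]].
  (* The variables of the other disjunct take the default [x0], as index domains are nonempty. *)
  pose x (k : 'I_(ilen K + ilen H)) := if split k is inl j then i j else x0.
  have xE : (fun v => x (lshift (ilen H) v)) = i.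
    by apply/funext => v; rewrite /x (unsplitK (inl v)).
  exists x; left; apply/meval_rename.
  by rewrite -xE in Ki.
pose x (k : 'I_(ilen K + ilen H)) := if split k is inr j then i j else x0.
have xE : (fun v => x (rshift (ilen K) v)) = i.
  by apply/funext => v; rewrite /x (unsplitK (inr v)).
exists x; right; apply/meval_rename.
by rewrite -xE in Hi.
Qed.

Lemma exI_disj (k : nat) (K : 'I_k -> iformula SI SE) : exists D : iformula SI SE,
  forall M (a : array M), exI D a <-> exists i, exI (K i) a.
Proof.
elim: k K => [|k IH] K.
  by exists (@IFormula _ _ 0 QFalse) => M a; split=> [[]|[[]]].
have [D DP] := IH (fun i => K (lift ord0 i)).
have [E EP] := exI_or (K ord0) D; exists E => M a; rewrite EP DP; split.
  by move=> [K0|[i Ki]]; [exists ord0|exists (lift ord0 i)].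
move=> [i]; case: (unliftP ord0 i) => [j|] -> Ki; last by left.
by right; exists j.
Qed.

Definition negated K : iformula SI SE := IFormula (QNot (imatrix K)).

Lemma allI_negated K M (a : array M) : allI (negated K) a <-> ~ exI K a.
Proof.
by split=> [H [i]|H i Ki]; [exact: H|apply: H; exists i].
Qed.

Lemma exI_negated K M (a : array M) : exI (negated K) a <-> ~ allI K a.
Proof. by split=> [[i nKi] /(_ i)//|/existsNP]. Qed.

Lemma is_allI_neg_disj (k : nat) (K : 'I_k -> iformula SI SE) :
  is_allI (neg_disj (TI := TI) (TE := TE) K).
Proof.
have [D DP] := exI_disj K; exists (negated D) => M a.
by rewrite allI_negated DP.
Qed.

(** * Sub-reachability and the new invariant *)

Lemma sub_reachable_cons (Sys : array_system TI TE) s s' t :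
  conf_le s s' \/ predecessor Sys s s' -> sub_reachable Sys s' t ->
  sub_reachable Sys s t.
Proof.
move=> ss' [n [c [c0 cn cP]]].
exists n.+1, (fun i => if i is j.+1 then c j else s); split=> //.
by case=> [|i] /= ltin; [rewrite c0|exact: cP].
Qed.

End Configurations.

Theorem theorem5p10 (SI SE : signature) (TI : theory SI) (TE : theory SE)
    (TI_lf : locally_finite TI) (TI_sub : closed_under_substructures TI)
    (TI_dec : qf_sat_decidable TI) (TE_dec : qf_sat_decidable TE)
    (TE_lf : locally_finite TE)
    (Sys : array_system TI TE) (U : iformula SI SE)
    (U_safe : exists J : array_pred TI TE, safety_invariant Sys U J) :
  exists (k : nat) (s : 'I_k -> configuration TI TE),
    (forall i, sub_reachable_from Sys (s i) U) /\
    (exists K : 'I_k -> iformula SI SE, forall i, is_K_of (s i) (K i)) /\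
    (forall K : 'I_k -> iformula SI SE, (forall i, is_K_of (s i) (K i)) ->
       safety_invariant Sys U (neg_disj (TI := TI) (TE := TE) K)).
Proof.
case: U_safe => J [[KJ KJE] initJ stepJ UJ].
pose H := negated KJ.
have HE M (a : array M) : exI H a <-> ~ J M a by rewrite exI_negated KJE.
have [m [f fH]] := local_generates TI_lf TE_lf
  (@local_exI _ _ _ _ TI_sub H) (@up_closed_exI _ _ TI TE H).
have geH t : hat (exI H) t -> exists i, conf_le (f i) t.
  by rewrite fH => -[_ [i _ <-]]; exists i.
have fiH i : hat (exI H) (f i).
  by rewrite fH; exists (f i); [exists i|exact: conf_le_refl].
pose A := [set i | `[< sub_reachable_from Sys (f i) U >]]%SET.
pose s (i : 'I_#|A|) := f (enum_val i).
have sA i : sub_reachable_from Sys (f i) U -> exists j, s j = f i.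
  move=> fi; have iA : i \in A by rewrite inE; apply/asboolP.
  by exists (enum_rank_in iA i); rewrite /s enum_rankK_in.
have sU i : sub_reachable_from Sys (s i) U.
  by have := enum_valP i; rewrite inE => /asboolP.
exists #|A|, s; split=> //; split.
  have /choice[K KP] i := exists_K_of TI_lf TE_lf (s i).
  by exists K.
move=> K KP.
have [D DE] := exI_disj TI TE K.
have sD i t : conf_le (s i) t -> hat (exI D) t.
  move=> st; apply/DE; exists i; change (hat (exI (K i)) t).
  by rewrite KP.
have DH (t : configuration TI TE) : hat (exI D) t -> hat (exI H) t.
  move=> Dt; have [i Ki] := iffLR (DE _ _) Dt.
  have : hat (exI (K i)) t by [].
  by rewrite KP => st; exact: (up_closed_exI st (fiH _)).
(* The inclusion passes from configurations to all models. *)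
have {}DH := local_subset TI_lf (@local_exI _ _ _ _ TI_sub D) DH.
have nD (M : model TI TE) (a : array M) : neg_disj K a <-> ~ exI D a by rewrite DE.
split.
- exact: is_allI_neg_disj.
- by move=> M a /initJ Ja; apply/nD => /DH /HE.
- move=> M a a' [/nD nDa aa']; apply/nD => /DE[i Ka']; apply: nDa.
  apply: (local_subset TI_lf (@local_Pre _ _ _ _ TI_sub Sys (K i))); last by exists a'.
  have [B BP] := local_basis TI_lf TE_lf
    (@local_Pre _ _ _ _ TI_sub Sys (K i)) (@up_closed_Pre _ _ TI TE Sys (K i)).
  have [_ BE _] := BP; move=> t Pt.
  have [p Bp pt] : (\bigcup_(p in B) up p) t by rewrite -BE.
  apply: (up_closed_exI pt).
  have [b [pb Kb]] : hat (Pre Sys (exI (K i))) p.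
    by rewrite BE; exists p => //; exact: conf_le_refl.
  (* If [J] held at [p] it would hold at its successor [b], which satisfies [D] and hence [H]. *)
  have [j jp] : exists j, conf_le (f j) p.
    apply/geH/HE => Jp; have Jb := stepJ _ _ _ (conj Jp pb).
    by have /DH/HE : exI D b by apply/DE; exists i.
  (* The chain from [s i] is prolonged twice: [p] is a predecessor of [s i], and [f j] lies below
     [p]. *)
  suff /sA[l lj] : sub_reachable_from Sys (f j) U by apply: (sD l); rewrite lj.
  have [BU [u [BUP BUu su]]] := sU i; exists BU, u; split=> //.
  apply: sub_reachable_cons (or_introl jp) _.
  by apply: sub_reachable_cons su; right; exists (K i), B.
- move=> [M [a [Ua /nD]]]; apply.
  apply: (local_subset TI_lf (@local_exI _ _ _ _ TI_sub U)) Ua => t Ut.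
  have [B BP] := local_basis TI_lf TE_lf
    (@local_exI _ _ _ _ TI_sub U) (@up_closed_exI _ _ TI TE U).
  have [_ BE _] := BP.
  have [u Bu ut] : (\bigcup_(u in B) up u) t by rewrite -BE.
  apply: (up_closed_exI ut).
  (* A basis element of [U] satisfies [U], so [J] fails there. *)
  have [j ju] : exists j, conf_le (f j) u.
    apply/geH/HE => Ju; apply: UJ; exists (cmodel u), (@carr _ _ _ _ u); split=> //.
    have : hat (exI U) u by rewrite BE; exists u => //; exact: conf_le_refl.
    by [].
  suff /sA[l lj] : sub_reachable_from Sys (f j) U by apply: (sD l); rewrite lj.
  exists B, u; split=> //; apply: sub_reachable_cons (or_introl ju) _.
  by exists 0, (fun=> u); split.
Qed.
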